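(* Let $p\ge 1$ and $n\ge 1$ be integers, and let $w$ be any word of length $2n$ consisting of $n$ letters $L$ and $n$ letters $R$, in any order. Consider $p$ random turns walkers on $\mathbb{Z}$, initially equally spaced one unit apart (walker $j$ at site $j$, $j=1,\dots,p$), returning to their initial positions after $2n$ steps, and making their steps in the sequence $w$. Then the total number of distinct configurations equals the number of permutations of $\{1,\dots,n\}$ such that the length of the maximum increasing subsequence is less than or equal to $p$.
   Context: Random turns walkers: $p$ labelled walkers occupy distinct sites of $\mathbb{Z}$. At each time step $t=1,2,\dots,2n$ exactly one walker moves, by exactly one lattice site, either to the left (a step $L$, position decreases by $1$) or to the right (a step $R$, position increases by $1$), while all other walkers stay where they are; at no time may two walkers occupy the same lattice site. A configuration is a full history of such moves: a sequence $x(0),x(1),\dots,x(2n)$ with $x(t)=(x_1(t),\dots,x_p(t))\in\mathbb{Z}^p$ having pairwise distinct entries, where $x(t)$ and $x(t-1)$ differ in exactly one coordinate and by exactly $\pm1$ in that coordinate, and $x(0)=x(2n)=(1,2,\dots,p)$. Two configurations are distinct if they differ as sequences. For this counting problem left and right moves are weighted equally, so it is simply the number of configurations that is counted. A configuration makes its steps in the sequence $w$ if, for each $t$, the walker moving at time $t$ moves in the direction given by the $t$-th letter of $w$. An increasing subsequence of a permutation $\pi$ of $\{1,\dots,n\}$ is $\pi(i_1)<\pi(i_2)<\dots<\pi(i_k)$ with $i_1<i_2<\dots<i_k$; its length is $k$. *)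

(* Defs.v *)
From HB Require Import structures.
From mathcomp Require Import all_boot all_order all_algebra all_fingroup.
From mathcomp Require Import finmap.

Set Implicit Arguments.
Unset Strict Implicit.
Unset Printing Implicit Defensive.

Import Order.TTheory GRing.Theory Num.Theory.

Local Open Scope ring_scope.

Inductive letter := L | R.

Definition bool_of_letter (a : letter) : bool := if a is R then true else false.
Definition letter_of_bool (b : bool) : letter := if b then R else L.

Lemma bool_of_letterK : cancel bool_of_letter letter_of_bool.
Proof. by case. Qed.

HB.instance Definition _ := Equality.copy letter (can_type bool_of_letterK).

Definition displacement (a : letter) : int :=
  match a with L => -1 | R => 1 end.

Section Walkers.

Variables p n : nat.

Definition positions := {ffun 'I_p -> int}.

(* The histories x(0), ..., x(2n). *)
Definition history := {ffun 'I_(2 * n).+1 -> positions}.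

(* Walkers are numbered from 0, so that walker j starts at site j + 1. *)
Definition initial : positions := [ffun j : 'I_p => (j.+1)%:Z].

Definition single_move (y z : positions) : bool :=
  [exists j, (`|z j - y j| == 1) && [forall k, (k != j) ==> (z k == y k)]].

(* An index t : 'I_(2 * n) stands for the time step from time t to t + 1. *)
Definition configuration (x : history) : bool :=
  [&& [forall t, injectiveb (x t)],
      [forall t : 'I_(2 * n), single_move (x (inord t)) (x (inord t.+1))],
      x ord0 == initial
    & x ord_max == initial].

Definition makes_steps (w : (2 * n).-tuple letter) (x : history) : bool :=
  [forall t : 'I_(2 * n), forall j : 'I_p,
    (x (inord t.+1) j != x (inord t) j) ==>
    (x (inord t.+1) j - x (inord t) j == displacement (tnth w t))].

End Walkers.

Section IncreasingSubsequences.

Variable n : nat.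

(* s lists the positions i_1, ..., i_k of the subsequence. *)
Definition increasing_subseq (pi : {perm 'I_n}) (s : seq 'I_n) : bool :=
  sorted (fun i j : 'I_n => (i < j)%N && (pi i < pi j)%N) s.

(* The bound k <= n loses nothing, as the listed positions are distinct. *)
Definition max_increasing_length (pi : {perm 'I_n}) : nat :=
  (\max_(k < n.+1 | [exists s : k.-tuple 'I_n, increasing_subseq pi s]) k)%N.

End IncreasingSubsequences.

(* Main.v *)
Require Import Defs.
From mathcomp Require Import all_boot all_order all_algebra all_fingroup.
From mathcomp Require Import finmap zify.

(** Let [step R] and [step L] be the operators that send a function of the
positions to its sum over all positions reached by one right, respectively left,
move.  Read as a product of these operators, the word [w] sends the indicator of
the initial positions to the function that counts the walks with step word [w]
back to the initial positions ([count_walks]).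

The two operators commute on injective positions ([step_comm]).  Moves of two
different walkers can be exchanged, and a walker that moves and comes straight
back can do so as often to the right as to the left: the number of walkers whose
right neighbour site is free equals the number of those whose left neighbour
site is free.  So the count depends only on the numbers of letters, and the word
may be taken to be R^n L^n.

For this word no walker is ever left of its home site, so positions are
partitions with at most [p] parts, and the walks are pairs of standard tableaux
of equal shape.  The claim becomes the Robinson-Schensted correspondence with
Schensted's theorem.  The correspondence is not built; instead both sides are
counted with a refined statistic and shown to obey the same recursion.

- For walks, the statistic is the number [away y] of walkers not at home.  The
  profile of a walk of left moves from [y] to the initial positions is the
  list of these numbers before each step, and [descent_sum k phi y] sums [phi]
  over the profiles of all such walks of [k] steps.  Commuting one right move through [k] left
  moves acts on profiles by [insert_value]: [step_descent_sum_insert].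

- For permutations of k values, the profile lists, for b = k, ..., 1, the length
  of the longest increasing subsequence that uses only the b smallest values.
  Appending a last entry acts on profiles by the same [insert_value]:
  [profile_lift_perm].

Both counts therefore equal [profile_sum].  The head of the profile is the
number of walkers away from home, which cannot exceed [p], on one side, and the
maximum length of an increasing subsequence on the other. *)

Set Implicit Arguments.
Unset Strict Implicit.
Unset Printing Implicit Defensive.

Import GRing.Theory.

(** * Left and right moves commute *)

Section Commutation.
Local Open Scope ring_scope.

Definition move p (a : letter) (j : 'I_p) (y : positions p) : positions p :=
  [ffun k => y k + (if k == j then displacement a else 0)].

(** That the target site is free is expressed, as in the histories, by the
injectivity of the positions after the move. *)
Definition step p (a : letter) (f : positions p -> nat) (y : positions p) : nat :=
  (\sum_(j | injectiveb (move a j y)) f (move a j y))%N.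

Definition opposite a := if a is L then R else L.

Lemma moveK p a (j : 'I_p) y : move (opposite a) j (move a j y) = y.
Proof. by apply/ffunP => k; rewrite !ffunE; case: a; case: eqP => /=; lia. Qed.

Lemma moveC p a b (i j : 'I_p) y : move a i (move b j y) = move b j (move a i y).
Proof. by apply/ffunP => k; rewrite !ffunE addrAC. Qed.

Lemma inj_moveE p a (j : 'I_p) (y : positions p) : injective y ->
  injectiveb (move a j y) = [forall k, y k != y j + displacement a].
Proof.
move=> y_inj; apply/injectiveP/forallP => [inj k | free i k].
  apply/eqP => yk; have kj : k = j.
    apply: inj; rewrite !ffunE eqxx; case: eqP => [kj|_]; last by rewrite addr0.
    by subst k; move: yk; case: (a) => /=; lia.
  by subst k; move: yk; case: (a) => /=; lia.
rewrite !ffunE; case: eqP => [->|ij]; case: eqP => [->|kj] //.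
- by rewrite addr0 => /esym yk; move: (free k); rewrite yk eqxx.
- by rewrite addr0 => yk; move: (free i); rewrite yk eqxx.
- by rewrite !addr0 => /y_inj.
Qed.

(** A walker that cannot move right has another walker as its right neighbour,
which then cannot move left.  Both sides therefore fall short of [p] by the
number of pairs of walkers on adjacent sites. *)
Lemma card_movable p (y : positions p) : injective y ->
  #|[pred j | injectiveb (move R j y)]| = #|[pred j | injectiveb (move L j y)]|.
Proof.
move=> y_inj; have count a :
    (#|[pred j | injectiveb (move a j y)]| +
       \sum_j \sum_k (y k == y j + displacement a)%R = p)%N.
  rewrite -sum1_card big_mkcond -big_split /= -[RHS](card_ord p) -sum1_card.
  apply: eq_bigr => j _; rewrite inE inj_moveE //.
  case: forallP => [free | /forallP].
    by rewrite big1 ?addn0 // => k _; rewrite (negPf (free k)).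
  rewrite negb_forall => /existsP [k /negPn /eqP yk].
  rewrite (bigD1 k) //= -yk eqxx big1 // => i ik.
  by apply/eqP; rewrite eqb0; apply: contra ik => /eqP /y_inj ->.
apply/eqP; rewrite -(eqn_add2r (\sum_j \sum_k (y k == y j + displacement R)%R)).
rewrite count exchange_big /= -[X in X == _](count L) eqn_add2l.
apply/eqP; apply: eq_bigr => j _; apply: eq_bigr => k _.
by congr nat_of_bool; apply/eqP/eqP => /=; lia.
Qed.

(** If the left-hand order is possible but the right-hand one is not, then
walker [j] is blocked at first.  Only walker [i] can have unblocked it, but then
[j] itself is in the way of [i]. *)
Lemma inj_move_swap p a (i j : 'I_p) (y : positions p) : i != j -> injective y ->
  injectiveb (move a i y) && injectiveb (move (opposite a) j (move a i y)) =
  injectiveb (move (opposite a) j y) && injectiveb (move a i (move (opposite a) j y)).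
Proof.
wlog suff imp : a i j / i != j -> injective y ->
  injectiveb (move a i y) && injectiveb (move (opposite a) j (move a i y)) ->
  injectiveb (move (opposite a) j y) && injectiveb (move a i (move (opposite a) j y)).
  move=> ij y_inj; apply/idP/idP; first exact: imp.
  have := imp (opposite a) j i; rewrite eq_sym ij.
  have -> : opposite (opposite a) = a by case: (a).
  by move=> H; apply: H.
move=> ij y_inj /andP [inj1 inj2].
rewrite moveC inj2 andbT inj_moveE //; apply/forallP => k; apply/eqP => yk.
have kj : k <> j by move=> kj; subst k; move: yk; case: (a) => /=; lia.
have [ki|ki] := eqVneq k i.
  subst k; move: inj1; rewrite inj_moveE // => /forallP /(_ j) /eqP; apply.
  by move: yk; case: (a) => /=; lia.
move/injectiveP: inj2 => /(_ k j) inj2; apply: (kj); apply: inj2.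
rewrite !ffunE eqxx (negPf ki) [j == i]eq_sym (negPf ij).
by case: eqP => [//|_]; rewrite yk; case: (a) => /=; lia.
Qed.

(** The diagonal terms, in which the same walker moves and comes back, return
to [y] and need only the first move to be free.  The summand may depend on the
walker that moved first, so that a statistic of the intermediate positions can
be recorded. *)
Lemma step_opposite p a (f : 'I_p -> positions p -> nat) (y : positions p) :
  injective y ->
  (\sum_(i | injectiveb (move a i y)) step (opposite a) (f i) (move a i y) =
   \sum_(i | injectiveb (move a i y)) f i y +
   \sum_(i | injectiveb (move a i y))
     \sum_(j | injectiveb (move (opposite a) j (move a i y)) && (j != i))
       f i (move (opposite a) j (move a i y)))%N.
Proof.
move=> /injectiveP y_inj; rewrite -big_split; apply: eq_bigr => i _.
by rewrite /step (bigD1 i) ?moveK.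
Qed.

Lemma step_opposite_exchange p a (f : 'I_p -> 'I_p -> positions p -> nat)
    (y : positions p) : injective y ->
  (\sum_(i | injectiveb (move a i y))
     \sum_(j | injectiveb (move (opposite a) j (move a i y)) && (j != i))
       f i j (move (opposite a) j (move a i y)) =
   \sum_(j | injectiveb (move (opposite a) j y))
     \sum_(i | injectiveb (move a i (move (opposite a) j y)) && (i != j))
       f i j (move a i (move (opposite a) j y)))%N.
Proof.
move=> y_inj.
rewrite (exchange_big_dep (fun j => injectiveb (move (opposite a) j y))) /=.
  apply: eq_bigr => j inj_j; apply: eq_big => [i|i _]; last by rewrite moveC.
  rewrite eq_sym andbA; have [->|ij] := eqVneq i j; first by rewrite !andbF.
  by rewrite inj_move_swap // inj_j.
move=> i j inj_i /andP [inj_ij ji].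
have := inj_move_swap a (i := i) (j := j) (y := y); rewrite eq_sym inj_i inj_ij.
by case/(_ ji y_inj)/esym/andP.
Qed.

Lemma step_comm p (f : positions p -> nat) (y : positions p) : injective y ->
  step L (step R f) y = step R (step L f) y.
Proof.
move=> y_inj; rewrite [LHS](step_opposite L (fun=> f) y_inj).
rewrite [RHS](step_opposite R (fun=> f) y_inj).
congr addn.
  by rewrite !sum_nat_const (card_movable y_inj).
exact: (step_opposite_exchange L (fun _ _ => f)).
Qed.

(** The letters are read from the first step on, starting at the argument;
only the final positions are prescribed. *)
Definition count_walks p (w : seq letter) : positions p -> nat :=
  foldr (@step p) (fun y => y == initial p : nat) w.

Lemma eq_step p a (f g : positions p -> nat) y :
  (forall z : positions p, injective z -> f z = g z) -> step a f y = step a g y.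
Proof. by move=> fg; apply: eq_bigr => j /injectiveP /fg. Qed.

(** Commutation lets every [R] of the word be moved to the front. *)
Lemma count_walks_sorted p w (y : positions p) : injective y ->
  count_walks w y = count_walks (nseq (count_mem R w) R ++ nseq (count_mem L w) L) y.
Proof.
elim: w y => [//|a w IH] y y_inj.
transitivity (step a
    (count_walks (nseq (count_mem R w) R ++ nseq (count_mem L w) L)) y).
  exact: eq_step.
case: a; rewrite /= ?addn0 ?add0n ?add1n //.
elim: (count_mem R w) y y_inj => [//|r IHr] y y_inj /=.
by rewrite step_comm //; apply: eq_step => z /IHr.
Qed.

End Commutation.

(** * Counting the walkers away from home *)

Section HomeWalkers.
Local Open Scope ring_scope.

(** With [y i - i.+1] as parts, from the smallest to the largest, [y] is a
partition, except that parts may be negative.  For integer positions this is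
the same as strict monotonicity, but it also bounds the distance of walkers that
are not neighbours. *)
Definition ordered p (y : positions p) :=
  forall i k : 'I_p, (i <= k)%N -> y i - i%:Z <= y k - k%:Z.

Definition above p (y : positions p) := [forall i : 'I_p, i.+1%:Z <= y i].

Definition away p (y : positions p) := #|[pred i : 'I_p | y i != i.+1%:Z]|.

Lemma ordered_initial p : ordered (initial p).
Proof. by move=> i k ik; rewrite !ffunE; lia. Qed.

Lemma above_initial p : above (initial p).
Proof. by apply/forallP => i; rewrite ffunE. Qed.

Lemma away_initial p : away (initial p) = 0%N.
Proof. by apply: eq_card0 => i; rewrite inE ffunE eqxx. Qed.

Lemma away_le p (y : positions p) : (away y <= p)%N.
Proof. by rewrite -[X in (_ <= X)%N](card_ord p) max_card. Qed.

Lemma ordered_inj p (y : positions p) : ordered y -> injective y.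
Proof.
move=> y_ord i k yik; apply/val_inj => /=.
by have := y_ord i k; have := y_ord k i; rewrite yik; lia.
Qed.

(** Walkers move by one site, so they cannot change their order without
sharing a site first.  Only the neighbour of the moving walker matters. *)
Lemma ordered_move p a (j : 'I_p) (y : positions p) :
  ordered y -> injectiveb (move a j y) -> ordered (move a j y).
Proof.
move=> y_ord; rewrite inj_moveE; last exact: ordered_inj.
move=> /forallP free i k ik; rewrite !ffunE; have := y_ord _ _ ik.
have [ij|ij] := eqVneq i j; have [kj|kj] := eqVneq k j; rewrite ?addr0 //.
- by rewrite ij kj; lia.
- subst i; case: a free => /= free; first by lia.
  have jk : (j.+1 <= k)%N by rewrite ltn_neqAle ik eq_sym kj.
  pose j' := Ordinal (leq_ltn_trans jk (ltn_ord k)).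
  have := y_ord j j' (leqnSn j); have := y_ord j' k jk.
  by have := free j'; rewrite /=; lia.
- subst k; case: a free => /= free; last by lia.
  have ij' : (i <= j.-1)%N by move: ij ik; rewrite -val_eqE /=; lia.
  have jp : (j.-1 < p)%N by have := ltn_ord j; lia.
  have := y_ord (Ordinal jp) j (leq_pred j); have := y_ord i (Ordinal jp) ij'.
  by have := free (Ordinal jp); move: ij; rewrite -val_eqE /=; lia.
Qed.

Lemma above_moveR p (j : 'I_p) (y : positions p) : above y -> above (move R j y).
Proof.
move=> /forallP y_above; apply/forallP => i; rewrite ffunE.
by have := y_above i; case: eqP => _ /=; lia.
Qed.

Lemma above_moveL p (j : 'I_p) (y : positions p) :
  above y -> above (move L j y) = (y j != j.+1%:Z).
Proof.
move=> /forallP y_above; apply/forallP/idP => [/(_ j) | yj i]; rewrite ffunE.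
  by rewrite eqxx /=; lia.
by have := y_above i; case: eqP => [->|_] /=; lia.
Qed.

Lemma not_above_moveL p (j : 'I_p) (y : positions p) :
  ~~ above y -> ~~ above (move L j y).
Proof.
by apply: contraNN => /(above_moveR j); rewrite (moveK L).
Qed.

Lemma away_moveR p (j : 'I_p) (y : positions p) : above y ->
  away (move R j y) = (away y + (y j == j.+1%:Z))%N.
Proof.
move=> /forallP y_above; rewrite /away (cardD1 j) [in RHS](cardD1 j) !inE.
rewrite ffunE eqxx /=.
have -> : (y j + 1 != j.+1%:Z) = true by have := y_above j; lia.
rewrite addnAC; congr addn; first by case: eqP.
by apply: eq_card => i; rewrite !inE !ffunE; case: eqP => //= _; rewrite addr0.
Qed.

(** This is Fomin's local rule for the number of nonzero parts.  Both from [y]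
and from the final positions, the intermediate ones are reached by one right
move, which takes at most one walker away from home.  If it did so in both
cases, walker [i] would be at home and [j] away in [y], and the other way round
in the final positions; but all walkers at home are left of all walkers
away. *)
Lemma away_swap p (i j : 'I_p) (y : positions p) :
  i != j -> ordered y -> above y ->
  ordered (move L j (move R i y)) -> above (move L j (move R i y)) ->
  away (move R i y) = maxn (away (move L j (move R i y))) (away y).
Proof.
move=> ij y_ord y_above; set z := move L j _ => z_ord z_above.
have y_i : away (move R i y) = (away y + (y i == i.+1%:Z))%N by exact: away_moveR.
have z_j : away (move R i y) = (away z + (z j == j.+1%:Z))%N.
  by rewrite -away_moveR // /z (moveK L).
have : ~~ ((y i == i.+1%:Z) && (z j == j.+1%:Z)).
  apply/negP => /andP [/eqP yi /eqP zj]; have := y_ord j i; have := z_ord i j.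
  move: zj; rewrite /z !ffunE !eqxx (negPf ij) [j == i]eq_sym (negPf ij) /=.
  by move: ij; rewrite -val_eqE /=; lia.
by move: y_i z_j; do 2 case: eqP => _ /=; lia.
Qed.

(** The parts of a partition that vanish are consecutive and lie at the
left end. *)
Lemma home_prefix p (i k : 'I_p) (y : positions p) : ordered y -> above y ->
  (i <= k)%N -> y k = k.+1%:Z -> y i = i.+1%:Z.
Proof. by move=> y_ord /forallP /(_ i) + /y_ord => /[swap]; lia. Qed.

Lemma away_ltP p (y : positions p) :
  reflect (exists i : 'I_p, y i = i.+1%:Z) (away y < p)%N.
Proof.
rewrite -[X in (_ < X)%N](card_ord p) -(cardC [pred i : 'I_p | y i != i.+1%:Z]).
rewrite -[X in (X < _)%N]addn0 ltn_add2l.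
apply: (iffP card_gt0P) => -[i]; first by rewrite !inE negbK => /eqP yi; exists i.
by move=> yi; exists i; rewrite !inE yi eqxx.
Qed.

(** The home walkers form a block at the left end, and only its leftmost
member, walker 0, can move left. *)
Lemma card_home_moveL p (y : positions p) : ordered y -> above y ->
  #|[pred j : 'I_p | injectiveb (move L j y) && (y j == j.+1%:Z)]| = (away y < p)%N.
Proof.
move=> y_ord y_above; have y_inj := ordered_inj y_ord.
case: away_ltP => [[i yi] | none]; last first.
  apply: eq_card0 => j; rewrite inE; case: eqP => [yj|_]; last by rewrite andbF.
  by case: none; exists j.
pose o := Ordinal (leq_ltn_trans (leq0n i) (ltn_ord i)).
have yo : y o = 1 by rewrite (home_prefix (i := o) (k := i)).
apply: etrans (card1 o); apply: eq_card => j; rewrite !inE inj_moveE //.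
apply/andP/eqP => [[/forallP free /eqP yj] | ->].
  apply: val_inj => /=; case: (posnP j) => // j_gt0.
  have jp : (j.-1 < p)%N by have := ltn_ord j; lia.
  have := home_prefix y_ord y_above (i := Ordinal jp) (k := j) (leq_pred j) yj.
  by have := free (Ordinal jp); rewrite /= yj; lia.
by split; [apply/forallP => k; move/forallP: y_above => /(_ k) | ];
  rewrite yo /=; lia.
Qed.

(** In the block of home walkers only the rightmost member can move right, and
its right neighbour site is free because the next walker, if any, is away. *)
Lemma card_home_moveR p (y : positions p) : ordered y -> above y ->
  #|[pred j : 'I_p | injectiveb (move R j y) && (y j == j.+1%:Z)]| = (away y < p)%N.
Proof.
move=> y_ord y_above; have y_inj := ordered_inj y_ord.
case: away_ltP => [[i0 /eqP yi0] | none]; last first.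
  apply: eq_card0 => j; rewrite inE; case: eqP => [yj|_]; last by rewrite andbF.
  by case: none; exists j.
have [i /eqP yi max_i] := arg_maxnP (P := fun i => y i == i.+1%:Z) val yi0.
have {max_i} i_max j : y j == j.+1%:Z -> (j <= i)%N by apply: max_i.
apply: etrans (card1 i); apply: eq_card => j; rewrite !inE inj_moveE //.
apply/andP/eqP => [[/forallP free yj] | ->].
  apply/val_inj/anti_leq; rewrite i_max //= leqNgt; apply/negP => ji.
  pose j' := Ordinal (leq_ltn_trans ji (ltn_ord i)).
  have := home_prefix y_ord y_above (i := j') (k := i) ji yi.
  by have := free j'; rewrite /= (eqP yj); lia.
split; last by rewrite yi.
apply/forallP => k; apply/eqP; rewrite yi /= => yk.
have ki : (k <= i)%N.
  rewrite leqNgt; apply/negP => ik; have /forallP /(_ k) := y_above.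
  rewrite yk => ?; have := i_max k; rewrite yk /=; lia.
by have := home_prefix y_ord y_above ki yi; lia.
Qed.

End HomeWalkers.

(** * Commuting a right move through a sequence of left moves *)

Section Growth.
Local Open Scope ring_scope.

(** Profiles are read from the largest value down, and the inserted value has
[v] values above it.  Below the inserted value the profile is unchanged; the
value itself extends the best subsequence below it by one; above it this new
subsequence competes with the old ones.  The same operation is the effect of
inserting a number into the first row of a tableau. *)
Fixpoint insert_value (v : nat) (h : seq nat) : seq nat :=
  match v, h with
  | v'.+1, d :: h' => maxn (head 0%N (insert_value v' h')) d :: insert_value v' h'
  | _, _ => (head 0%N h).+1 :: h
  end.

(** The statistic of [y] is put in front before the remaining walk is
summed, so the head of every profile that counts is [away y]. *)
Fixpoint descent_sum p (k : nat) (phi : seq nat -> nat) : positions p -> nat :=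
  if k is k'.+1 then
    fun y => step L (descent_sum k' (fun h => phi (away y :: h))) y
  else fun y => ((y == initial p) * phi [::])%N.

(** Among [p] walkers at most [p] are away from home, so the profiles with
larger entries, which insertion can produce, must not contribute. *)
Definition capped p (phi : seq nat -> nat) :=
  forall h, (p < head 0%N h)%N -> phi h = 0%N.

Lemma head_insert v h : (head 0%N h <= head 0%N (insert_value v h))%N.
Proof. by case: v h => [|v] [|d h] //=; rewrite leq_maxr. Qed.

Lemma capped_insert p v phi : capped p phi -> capped p (phi \o insert_value v).
Proof. by move=> cap h ph; rewrite /= cap ?(leq_trans ph) ?head_insert. Qed.

(** For [k = 0] the profile is empty; its head reads 0, which is the right value
as nobody is away from home in the initial positions. *)
Lemma eq_descent_sum p k phi psi (y : positions p) :
  (forall h, head 0%N h = away y -> phi h = psi h) ->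
  descent_sum k phi y = descent_sum k psi y.
Proof.
elim: k phi psi y => [|k IH] phi psi y eq_phi /=.
  by case: eqP => // yE; rewrite eq_phi // yE away_initial.
by apply: eq_bigr => j _; apply: IH => h _; apply: eq_phi.
Qed.

Lemma descent_sum_out p k phi (y : positions p) : ~~ above y -> descent_sum k phi y = 0%N.
Proof.
elim: k phi y => [|k IH] phi y out /=; last first.
  by rewrite /step big1 // => j _; apply: IH; apply: not_above_moveL.
by case: eqP => // yE; move: out; rewrite yE above_initial.
Qed.

Lemma descent_sum0 p k (y : positions p) : descent_sum k (fun=> 0%N) y = 0%N.
Proof.
elim: k y => [|k IH] y /=; first by rewrite muln0.
by rewrite /step big1.
Qed.

(** One right move is commuted with the first left move.  When two different
walkers move, [away_swap] expresses the recorded statistic by its values before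
and after.  When the same walker moves and returns, the right moves that do not
change [away] are as many as the left moves that stay above home; what remains
is the one right move of a home walker, which exists if and only if some walker
is at home.  This move gives the first summand; if it does not exist, that
summand vanishes because [phi] is capped. *)
Lemma step_descent_sum p k phi (y : positions p) : capped p phi -> ordered y -> above y ->
  step R (descent_sum k.+1 phi) y =
  (descent_sum k (fun h => phi ((away y).+1 :: h)) y +
   \sum_(j | injectiveb (move L j y) && above (move L j y))
     step R (descent_sum k (fun h => phi (maxn (head 0 h) (away y) :: h)))
       (move L j y))%N.
Proof.
move=> cap y_ord y_above; have y_inj := ordered_inj y_ord.
pose F d := descent_sum k (fun h => phi (d :: h)) y.
pose psi h := phi (maxn (head 0%N h) (away y) :: h).
rewrite [LHS](step_opposite R
  (fun i => descent_sum k (fun h => phi (away (move R i y) :: h))) y_inj).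
rewrite big_mkcondr /=.
transitivity (F (away y).+1 + \sum_(j | injectiveb (move L j y))
     step R (fun z => above (move L j y) * descent_sum k psi z) (move L j y))%N; last first.
  congr addn; apply: eq_bigr => j _; case: ifP => Hj.
    by apply: eq_bigr => i _; rewrite mul1n.
  by rewrite /step big1.
rewrite (step_opposite L
  (fun j z => above (move L j y) * descent_sum k psi z)%N y_inj) addnA.
congr addn.
  have FE : descent_sum k psi y = F (away y).
    by apply: eq_descent_sum => h; rewrite /psi => ->; rewrite maxnn.
  (* If no walker is at home, the cap annihilates this summand. *)
  have Fp : ((away y < p) * F (away y).+1 = F (away y).+1)%N.
    case: ltnP => [_|pm]; first by rewrite mul1n.
    rewrite mul0n -[LHS](descent_sum0 k y); apply: eq_descent_sum => h _.
    by rewrite cap.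
  rewrite (bigID (fun i : 'I_p => y i == i.+1%:Z)) /=.
  under eq_bigr => i /andP [_ home] do
    rewrite away_moveR // home addn1 -/(F (away y).+1).
  under [X in (_ + X)%N]eq_bigr => i /andP [_ home] do
    rewrite away_moveR // (negPf home) addn0 -/(F (away y)).
  rewrite !sum_nat_const FE; rewrite card_home_moveR // Fp; congr addn.
  under eq_bigr => i _ do rewrite above_moveL //.
  rewrite -big_distrl /= -big_mkcondr sum1_card; congr muln.
  apply/eqP; rewrite -(eqn_add2l (away y < p)) -{1}(card_home_moveR y_ord y_above).
  rewrite -(card_home_moveL y_ord y_above).
  have split a : #|[pred j : 'I_p | injectiveb (move a j y)]| =
     (#|[pred j : 'I_p | injectiveb (move a j y) && (y j == j.+1%:Z)]| +
      #|[pred j : 'I_p | injectiveb (move a j y) && (y j != j.+1%:Z)]|)%N.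
    rewrite -(cardID [pred j : 'I_p | y j == j.+1%:Z]).
    by congr addn; apply: eq_card => j; rewrite !inE // andbC.
  by rewrite -!split card_movable.
rewrite (step_opposite_exchange L
  (fun j i z => above (move L j y) * descent_sum k psi z)%N y_inj) /=.
apply: eq_bigr => i inj_i; apply: eq_bigr => j /andP [inj_ij ij].
set z := move L j _; have [z_above|z_out] := boolP (above z); last first.
  by rewrite !descent_sum_out // muln0.
have z_ord : ordered z by do 2 apply: ordered_move => //.
have -> : above (move L j y).
  have /forallP /(_ j) := z_above; rewrite above_moveL // !ffunE eqxx (negPf ij) /=.
  by lia.
rewrite mul1n; apply: eq_descent_sum => h hE; rewrite /psi hE.
by rewrite (away_swap (i := i) (j := j)) // eq_sym.
Qed.

(** Induction with [step_descent_sum]: its first summand is the insertion of a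
value above all others, and its sum over [j] inserts below the top value.  For
[k = 0] both sides vanish, as a right move from positions above home cannot end
in the initial positions. *)
Lemma step_descent_sum_insert p k phi (y : positions p) :
  capped p phi -> ordered y -> above y ->
  step R (descent_sum k phi) y =
  (\sum_(v < k) descent_sum k.-1 (phi \o insert_value v) y)%N.
Proof.
elim: k phi y => [|k IH] phi y cap y_ord y_above.
  rewrite big_ord0 /step big1 // => i _ /=; case: eqP => // yE.
  have : ~~ above y; last by rewrite y_above.
  apply/negP => /forallP /(_ i); have := congr1 (fun z : positions p => z i) yE.
  by rewrite !ffunE eqxx /=; lia.
rewrite step_descent_sum // big_ord_recl /=; congr addn.
  by apply: eq_descent_sum => h /= ->.
pose psi h := phi (maxn (head 0%N h) (away y) :: h).
have cap_psi : capped p psi by move=> h ph; rewrite /psi cap //= leq_max ph.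
rewrite (eq_bigr (fun j =>
    \sum_(v < k) descent_sum k.-1 (psi \o insert_value v) (move L j y))%N);
  last by move=> j /andP [inj_j above_j]; apply: IH => //; apply: ordered_move.
rewrite exchange_big /=; apply: eq_bigr => v _; case: k v {IH} => [[]//|k] v /=.
rewrite /step big_mkcondr; apply: eq_bigr => j _; case: ifPn => // out.
by rewrite descent_sum_out.
Qed.

(** The sum of [phi] over the profiles built from the empty one by [k]
insertions, the last one being outermost. *)
Fixpoint profile_sum (k : nat) (phi : seq nat -> nat) : nat :=
  if k is k'.+1 then (\sum_(v < k) profile_sum k' (phi \o insert_value v))%N else phi [::].

Lemma eq_step_ordered p (f g : positions p -> nat) y : ordered y -> above y ->
  (forall z, ordered z -> above z -> f z = g z) -> step R f y = step R g y.
Proof.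
move=> y_ord y_above fg; apply: eq_bigr => j inj_j.
by apply: fg; [apply: ordered_move | apply: above_moveR].
Qed.

(** Each right move is absorbed by one insertion, after which as many left
moves as right moves are left. *)
Lemma iter_step_descent_sum p k phi (y : positions p) :
  capped p phi -> ordered y -> above y ->
  iter k (step R) (descent_sum k phi) y = ((y == initial p) * profile_sum k phi)%N.
Proof.
elim: k phi y => [//|k IH] phi y cap y_ord y_above.
have iterE m (f g : positions p -> nat) z : ordered z -> above z ->
    (forall x, ordered x -> above x -> f x = g x) ->
    iter m (step R) f z = iter m (step R) g z.
  move=> z_ord z_above fg; elim: m z z_ord z_above => [|m IHm] z z_ord z_above /=.
    exact: fg.
  exact: eq_step_ordered.
have iter_sum m (f : 'I_k.+1 -> positions p -> nat) z :
    (iter m (step R) (fun x => \sum_v f v x) z = \sum_v iter m (step R) (f v) z)%N.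
  elim: m z => [//|m IHm] z /=; rewrite /step exchange_big /=.
  by apply: eq_bigr => j _; apply: IHm.
rewrite iterSr (iterE _ _ (fun x =>
    \sum_(v < k.+1) descent_sum k (phi \o insert_value v) x)%N) //;
  last by move=> x; apply: step_descent_sum_insert.
rewrite iter_sum /= big_distrr /=; apply: eq_bigr => v _; apply: IH => //.
exact: capped_insert.
Qed.

Lemma count_walks_cat p w1 w2 :
  @count_walks p (w1 ++ w2) = foldr (@step p) (count_walks w2) w1.
Proof. by rewrite /count_walks foldr_cat. Qed.

(** The weight that bounds the head by [p] is capped, and it does not exclude any
walk, because [away] is at most [p]. *)
Lemma count_walks_profile_sum p n (w : seq letter) :
  count_mem L w = n -> count_mem R w = n ->
  count_walks w (initial p) = profile_sum n (fun h => head 0%N h <= p)%N.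
Proof.
move=> wL wR; have init_ord := @ordered_initial p.
rewrite count_walks_sorted ?wL ?wR; last exact: ordered_inj.
rewrite count_walks_cat.
have foldr_nseq a (f : positions p -> nat) :
    foldr (@step p) f (nseq n a) = iter n (step a) f.
  by elim: (n) => //= m ->.
have count_walksE k : forall (y : positions p),
   count_walks (nseq k L) y = descent_sum k (fun h => head 0%N h <= p)%N y.
  move=> y; transitivity (descent_sum k (fun=> 1%N) y); last first.
    by apply: eq_descent_sum => h ->; rewrite away_le.
  elim: k y => [|k IH] y /=; first by rewrite muln1.
  by apply: eq_bigr => j _; apply: IH.
rewrite foldr_nseq; transitivity
  (iter n (step R) (descent_sum n (fun h => head 0%N h <= p)%N) (initial p)).
  elim: {1 3}n (initial p) => [|m IH] y /=; first exact: count_walksE.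
  by apply: eq_bigr => j _; apply: IH.
rewrite iter_step_descent_sum ?eqxx ?mul1n //; last exact: above_initial.
by move=> h; rewrite ltnNge => /negPf ->.
Qed.

End Growth.

(** * Longest increasing subsequences under insertion of a last entry *)

Definition increasing n (pi : {perm 'I_n}) : rel 'I_n :=
  fun i j => (i < j) && (pi i < pi j).

Lemma increasing_trans n (pi : {perm 'I_n}) : transitive (increasing pi).
Proof.
move=> j i k /andP [ij pij] /andP [jk pjk].
by rewrite /increasing (ltn_trans ij) ?(ltn_trans pij).
Qed.

Lemma increasing_subseqE n (pi : {perm 'I_n}) s :
  increasing_subseq pi s = pairwise (increasing pi) s.
Proof. exact/sorted_pairwise/increasing_trans. Qed.

(** Values start at 0, so the bound [b] admits the [b] smallest values. *)
Definition lis n (pi : {perm 'I_n}) (b : nat) : nat :=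
  \max_(k < n.+1 | [exists s : k.-tuple 'I_n,
                     increasing_subseq pi s && all (fun i => pi i < b) s]) k.

Lemma lis_max n (pi : {perm 'I_n}) b s :
  pairwise (increasing pi) s -> all (fun i => pi i < b) s -> size s <= lis pi b.
Proof.
rewrite -increasing_subseqE => s_inc s_lt.
have s_le : size s < n.+1.
  rewrite ltnS -[X in _ <= X](card_ord n).
  have /card_uniqP <- : uniq s; last exact: max_card.
  apply: (sorted_uniq (@increasing_trans _ pi)) s_inc => i.
  by rewrite /increasing ltnn.
apply: (bigmax_sup (Ordinal s_le)) => //.
by apply/existsP; exists (in_tuple s); rewrite s_inc.
Qed.

Lemma lis_attained n (pi : {perm 'I_n}) b : exists s,
  [/\ pairwise (increasing pi) s, all (fun i => pi i < b) s & size s = lis pi b].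
Proof.
pose P := [pred k : 'I_n.+1 | [exists s : k.-tuple 'I_n,
  increasing_subseq pi s && all (fun i => pi i < b) s]].
have P0 : P ord0 by apply/existsP; exists [tuple].
have [|k Pk kE] := eq_bigmax_cond (A := P) val; first by apply/card_gt0P; exists ord0.
move: Pk; rewrite inE => /existsP [s /andP [s_inc s_lt]].
exists s; split=> //; first by rewrite -increasing_subseqE.
by rewrite size_tuple; exact: esym kE.
Qed.

Lemma lis_mono n (pi : {perm 'I_n}) b c : b <= c -> lis pi b <= lis pi c.
Proof.
move=> bc; have [s [s_inc s_lt <-]] := lis_attained pi b; apply: lis_max => //.
by apply: sub_all s_lt => i /leq_trans ->.
Qed.

Lemma lis0 n (pi : {perm 'I_n}) : lis pi 0 = 0.
Proof. by have [[|i s] [_ //]] := lis_attained pi 0. Qed.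

Lemma lis_full n (pi : {perm 'I_n}) : lis pi n = max_increasing_length pi.
Proof.
apply: eq_bigl => k; apply: eq_existsb => s.
by rewrite (_ : all _ s) ?andbT //; apply/allP => i _; apply: ltn_ord.
Qed.

(** In [lift_perm ord_max j s] the values from [j] on are shifted by one and
[j] is appended.  A bound [b] on the new values is a bound [c] on the old. *)
Lemma lift_perm_map k (j : 'I_k.+1) (s : {perm 'I_k}) b c t :
  (forall x : 'I_k, (lift j x < b) = (x < c)) ->
  (pairwise (increasing (lift_perm ord_max j s)) (map (lift ord_max) t) =
     pairwise (increasing s) t) *
  (all (fun i => lift_perm ord_max j s i < b) (map (lift ord_max) t) =
     all (fun i => s i < c) t).
Proof.
move=> bc; rewrite pairwise_map all_map; split.
  apply: eq_pairwise => i i'; rewrite /increasing /= !lift_perm_lift /= /bump.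
  by have := ltn_ord i; have := ltn_ord i'; lia.
by apply: eq_all => i /=; rewrite lift_perm_lift bc.
Qed.

Lemma lift_all k (t : seq 'I_k.+1) :
  all (fun i : 'I_k.+1 => i < k) t ->
  exists t' : seq 'I_k, t = map (lift ord_max) t'.
Proof.
elim: t => [_|i t IH /= /andP [ik /IH [t' ->]]]; first by exists [::].
exists (Ordinal ik :: t') => /=; congr cons.
exact/val_inj/esym/lift_max.
Qed.

(** An increasing subsequence can use the last position only as its last
term.  Without it, it is a subsequence of [s]; with it, it extends one with
values below [j]. *)
Lemma lis_lift_perm k (j : 'I_k.+1) (s : {perm 'I_k}) b :
  lis (lift_perm ord_max j s) b =
    if b <= j then lis s b else maxn (lis s b.-1) (lis s j).+1.
Proof.
set pi := lift_perm _ _ _.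
have low c : c <= j -> forall x : 'I_k, (lift j x < c) = (x < c).
  by move=> cj x; rewrite /= /bump; lia.
have high c : j < c -> forall x : 'I_k, (lift j x < c) = (x < c.-1).
  by move=> cj x; rewrite /= /bump; lia.
apply/eqP; rewrite eqn_leq; apply/andP; split.
  have [t [t_inc t_lt <-]] := lis_attained pi b.
  case/lastP: t t_inc t_lt => [//|t x]; rewrite pairwise_rcons all_rcons.
  move=> /andP [tx t_inc] /andP [xb t_lt]; rewrite size_rcons.
  have [t' tE] : exists t', t = map (lift ord_max) t'.
    apply: lift_all; apply: sub_all tx => i /andP [/leq_trans ix _].
    by apply: ix; rewrite -ltnS ltn_ord.
  have [x_max|x_max] := eqVneq x ord_max.
    subst x; move: xb; rewrite lift_perm_id ltnNge => /negPf ->.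
    rewrite leq_max ltnS orbC tE size_map.
    have H := lift_perm_map s t' (low j (leqnn j)).
    rewrite lis_max // -H -?tE //.
    by apply: sub_all tx => i /andP [_]; rewrite lift_perm_id.
  have xk : x < k by have := ltn_ord x; move: x_max; rewrite -val_eqE /=; lia.
  have [u uE] : exists u, rcons t x = map (lift ord_max) u.
    exists (rcons t' (Ordinal xk)); rewrite map_rcons -tE; congr rcons.
    exact/val_inj/esym/lift_max.
  have u_inc : pairwise (increasing pi) (rcons t x) by rewrite pairwise_rcons tx.
  have u_lt : all (fun i => pi i < b) (rcons t x) by rewrite all_rcons xb.
  rewrite -(size_rcons t x) uE size_map; rewrite uE in u_inc u_lt.
  case: (leqP b j) => bj; last rewrite leq_max.
    have H := lift_perm_map s u (low b bj).
    by rewrite lis_max // -H.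
  have H := lift_perm_map s u (high b bj).
  by rewrite lis_max // -H.
case: (leqP b j) => bj; last rewrite geq_max.
  have [t [t_inc t_lt <-]] := lis_attained s b.
  have H := lift_perm_map s t (low b bj).
  by rewrite -(size_map (lift ord_max)) lis_max // H.
apply/andP; split.
  have [t [t_inc t_lt <-]] := lis_attained s b.-1.
  have H := lift_perm_map s t (high b bj).
  by rewrite -(size_map (lift ord_max)) lis_max // H.
have [t [t_inc t_lt <-]] := lis_attained s j.
have H := lift_perm_map s t (low j (leqnn j)).
rewrite -(size_map (lift ord_max)) -(size_rcons _ ord_max) lis_max //.
  rewrite pairwise_rcons H t_inc andbT; apply/allP => i it.
  rewrite /increasing lift_perm_id; apply/andP; split.
    by case/mapP: it => i' _ ->; rewrite lift_max ltn_ord.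
  by move: t_lt; rewrite -H => /allP /(_ _ it).
rewrite all_rcons lift_perm_id bj; move: t_lt; rewrite -H.
by apply: sub_all => i /ltn_trans ->.
Qed.

Fixpoint values_down (f : nat -> nat) (k : nat) : seq nat :=
  if k is k'.+1 then f k :: values_down f k' else [::].

Definition profile n (pi : {perm 'I_n}) := values_down (lis pi) n.

Lemma head_profile n (pi : {perm 'I_n}) : head 0 (profile pi) = lis pi n.
Proof. by case: n pi => [|n] pi //=; rewrite lis0. Qed.

(** [j] is the inserted value and [d] the number of values above it, so that the
induction on [d] follows the recursion of [insert_value]. *)
Lemma insert_values_down (f g : nat -> nat) (j d : nat) :
  f 0 = 0 -> {homo f : b c / b <= c} ->
  (forall b, g b = if b <= j then f b else maxn (f b.-1) (f j).+1) ->
  insert_value d (values_down f (j + d)) = values_down g (j + d).+1.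
Proof.
move=> f0 f_mono gE; elim: d => [|d IH].
  have low m : m <= j -> values_down f m = values_down g m.
    by elim: m => //= m IH mj; rewrite gE mj IH // ltnW.
  have -> : insert_value 0 (values_down f (j + 0)) =
     (head 0 (values_down f j)).+1 :: values_down f j by rewrite addn0.
  rewrite addn0 /= gE ltnn /= low //; congr cons.
  by rewrite -low // (maxn_idPr (leqnSn _)); case: (j) => //=; rewrite f0.
rewrite addnS [LHS]/= IH /=; congr cons; rewrite !gE.
have jd : j <= j + d by apply: leq_addr.
rewrite !ifN -?ltnNge ?ltnS //=; last exact: leqW.
by have := f_mono (j + d) (j + d).+1 (leqnSn _); lia.
Qed.

(** [rev_ord v] turns the number of values above the last entry into that
entry. *)
Lemma profile_lift_perm k (v : 'I_k.+1) (s : {perm 'I_k}) :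
  profile (lift_perm ord_max (rev_ord v) s) = insert_value v (profile s).
Proof.
have kE : rev_ord v + v = k by have := ltn_ord v; rewrite /=; lia.
rewrite /profile -[X in insert_value _ (values_down _ X)]kE.
rewrite (@insert_values_down _ (lis (lift_perm ord_max (rev_ord v) s))) ?kE ?lis0 //.
  exact: lis_mono.
exact: lis_lift_perm.
Qed.

Lemma lift_perm_bij k :
  bijective (fun u : 'I_k.+1 * {perm 'I_k} => lift_perm ord_max (rev_ord u.1) u.2).
Proof.
apply: inj_card_bij => [[v s] [v' s'] /= eq_lift|].
  have vv' : v = v'.
    by have := congr1 (fun pi : {perm 'I_k.+1} => pi ord_max) eq_lift;
      rewrite !lift_perm_id => /rev_ord_inj.
  congr pair => //; apply/permP => i; subst v'.
  have := congr1 (fun pi : {perm 'I_k.+1} => pi (lift ord_max i)) eq_lift.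
  by rewrite !lift_perm_lift => /lift_inj.
by rewrite card_prod card_ord !card_Sn factS.
Qed.

Lemma profile_sumE k phi :
  profile_sum k phi = \sum_(pi : {perm 'I_k}) phi (profile pi).
Proof.
elim: k phi => [|k IH] phi /=.
  rewrite (big_pred1 1%g) // => pi /=; apply/esym/eqP/permP => i.
  by case: i.
rewrite (reindex _ (onW_bij _ (@lift_perm_bij k))) /=.
under eq_bigr => v _ do rewrite IH.
rewrite pair_big /=.
by apply: eq_bigr => -[v s] _ /=; rewrite profile_lift_perm.
Qed.

Lemma profile_sum_lis n p :
  profile_sum n (fun h => head 0 h <= p) =
  #|[set pi : {perm 'I_n} | max_increasing_length pi <= p]|.
Proof.
rewrite profile_sumE -sum1_card [RHS]big_mkcond /=.
by apply: eq_bigr => pi _; rewrite head_profile lis_full inE; case: ifP.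
Qed.

(** * Walks as histories *)

Section Histories.
Local Open Scope ring_scope.

Fixpoint walk_list p (w : seq letter) (y : positions p) : seq (seq (positions p)) :=
  if w is a :: w' then
    flatten [seq map (cons (move a j y)) (walk_list w' (move a j y))
            | j <- enum 'I_p & injectiveb (move a j y)]
  else if y == initial p then [:: [::]] else [::].

(** [s] lists the positions after each step; [y] itself is not listed. *)
Fixpoint is_walk p (w : seq letter) (y : positions p) (s : seq (positions p)) : bool :=
  match w, s with
  | a :: w', z :: s' =>
      [&& injectiveb z, [exists j, z == move a j y] & is_walk w' z s']
  | [::], [::] => y == initial p
  | _, _ => false
  end.

Lemma size_walk_list p w (y : positions p) : size (walk_list w y) = count_walks w y.
Proof.
elim: w y => [|a w IH] y /=; first by case: eqP.
rewrite size_flatten /shape -map_comp sumnE big_map big_filter big_enum_cond /=.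
by apply: eq_bigr => j _; rewrite size_map IH.
Qed.

Lemma mem_walk_list p w (y : positions p) s : (s \in walk_list w y) = is_walk w y s.
Proof.
elim: w y s => [|a w IH] y s /=.
  by case: eqP => _; case: s.
apply/idP/idP => [/flatten_mapP [j] | ].
  rewrite mem_filter => /andP [inj_j _] /mapP [s' s'_in ->].
  by rewrite inj_j -IH s'_in andbT; apply/existsP; exists j.
case: s => [//|z s] /and3P [inj_z /existsP [j /eqP zE] s_walk].
apply/flatten_mapP; exists j; first by rewrite mem_filter -zE inj_z mem_enum.
by rewrite -zE; apply: map_f; rewrite IH.
Qed.

Lemma move_eq p a (i j : 'I_p) y : move a i y = move a j y -> i = j.
Proof.
move=> /(congr1 (fun z : positions p => z i)); rewrite !ffunE eqxx.
by case: eqP => // _; case: a => /=; lia.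
Qed.

Lemma uniq_walk_list p w (y : positions p) : uniq (walk_list w y).
Proof.
elim: w y => [|a w IH] y /=; first by case: eqP.
have: uniq [seq j <- enum 'I_p | injectiveb (move a j y)].
  by rewrite filter_uniq ?enum_uniq.
elim: [seq _ <- _ | _] => //= j r IHr /andP [jr r_uniq]; rewrite cat_uniq IHr //.
rewrite map_inj_uniq ?IH ?andbT => [|s s' [] //].
apply/hasPn => s /flatten_mapP [i ir /mapP [s' _ ->]].
by apply/mapP => -[s'' _ [/move_eq ij _]]; move: jr; rewrite -ij ir.
Qed.

Definition history_of p n (s : seq (positions p)) : history p n :=
  [ffun t : 'I_(2 * n).+1 => nth (initial p) (initial p :: s) t].

Lemma is_walkP p (w : seq letter) (y : positions p) s :
  reflect [/\ size s = size w,
     forall t, (t < size w)%N -> injective (nth y s t) /\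
         exists j, nth y s t = move (nth L w t) j (nth y (y :: s) t)
    & last y s = initial p]
   (is_walk w y s).
Proof.
elim: w y s => [|a w IH] y [|z s] /=.
- by apply: (iffP eqP) => [-> //|[]].
- by constructor => -[].
- by constructor => -[].
have nthz t u : (t < size u)%N -> nth z u t = nth y u t.
  by move=> ?; apply: set_nth_default.
apply: (iffP and3P) =>
  [[/injectiveP inj_z /existsP [j /eqP zE] /IH [sz moves end_]] | [[sz] moves end_]].
  split=> //; first by rewrite sz.
  move=> [|t] tw /=; first by split=> //; exists j.
  have := moves t tw; rewrite (nthz t s) ?sz //.
  by rewrite (nthz t (z :: s)) //= sz ltnW.
have [inj_z [j zE]] := moves 0%N isT; split; first exact/injectiveP.
  by apply/existsP; exists j; apply/eqP.
apply/IH; split=> // t tw; have := moves t.+1 tw.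
by rewrite /= (nthz t s) ?sz // (nthz t (z :: s)) //= sz ltnW.
Qed.

(** The direction is prescribed for every walker that moved, and exactly one
did. *)
Lemma single_stepP p a (y z : positions p) :
  reflect (exists j, z = move a j y)
    (single_move y z && [forall j, (z j != y j) ==> (z j - y j == displacement a)]).
Proof.
apply: (iffP andP) => [[/existsP [j /andP [zj /forallP fixed]] /forallP dir] | [j ->]].
  exists j; apply/ffunP => k; rewrite ffunE; have := fixed k.
  case: eqP => [-> _ | _ /= /eqP ->]; last by rewrite addr0.
  by have := dir j; move: zj; case: (a) => /=; case: eqP => /=; lia.
split; last first.
  apply/forallP => k; rewrite !ffunE; case: (k == j); last by rewrite addr0 eqxx.
  by rewrite [y k + _]addrC addrK eqxx implybT.
apply/existsP; exists j; rewrite !ffunE eqxx; apply/andP; split.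
  by case: a => /=; lia.
by apply/forallP => k; apply/implyP => /negPf kj; rewrite ffunE kj addr0.
Qed.

Lemma history_of_inord p n (s : seq (positions p)) t : (t <= 2 * n)%N ->
  history_of n s (inord t) = nth (initial p) (initial p :: s) t.
Proof. by move=> tn; rewrite ffunE inordK. Qed.

Lemma is_walk_history p n (w : (2 * n).-tuple letter) (s : seq (positions p)) :
  size s = (2 * n)%N ->
  is_walk w (initial p) s =
  configuration (history_of n s) && makes_steps w (history_of n s).
Proof.
move=> sz; have wsz : size w = (2 * n)%N by rewrite size_tuple.
have lastE : history_of n s ord_max = last (initial p) s.
  by rewrite ffunE /= -sz -last_nth.
have stateS t : (t < 2 * n)%N -> history_of n s (inord t.+1) = nth (initial p) s t.
  by move=> tn; rewrite history_of_inord.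
have state t : (t < 2 * n)%N ->
    history_of n s (inord t) = nth (initial p) (initial p :: s) t.
  by move=> tn; rewrite history_of_inord // ltnW.
have stepP (t : 'I_(2 * n)) := single_stepP (tnth w t)
  (history_of n s (inord t)) (history_of n s (inord t.+1)).
apply/is_walkP/andP => [[_] | [/and4P [inj moves _ end_] steps]]; rewrite wsz.
  move=> moves end_.
  have step_t (t : 'I_(2 * n)) : exists j, history_of n s (inord t.+1) =
      move (tnth w t) j (history_of n s (inord t)).
    by rewrite stateS ?state ?(tnth_nth L) //; case: (moves t (ltn_ord t)).
  have {stepP}step_t t := introT (stepP t) (step_t t).
  split; last by apply/forallP => t; case/andP: (step_t t).
  rewrite /configuration lastE end_ eqxx ffunE /= eqxx !andbT; apply/andP; split.
    apply/forallP => -[[|t] tn]; apply/injectiveP; rewrite ffunE /=.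
      exact/ordered_inj/ordered_initial.
    by case: (moves t).
  by apply/forallP => t; case/andP: (step_t t).
split=> // [t tn|]; last by rewrite -lastE (eqP end_).
split; first by rewrite -stateS //; apply/injectiveP/(forallP inj).
have /stepP : single_move (history_of n s (inord (Ordinal tn)))
    (history_of n s (inord (Ordinal tn).+1)) &&
  [forall j, (history_of n s (inord (Ordinal tn).+1) j
              != history_of n s (inord (Ordinal tn)) j) ==>
             (history_of n s (inord (Ordinal tn).+1) j
              - history_of n s (inord (Ordinal tn)) j
              == displacement (tnth w (Ordinal tn)))].
  by rewrite (forallP moves) (forallP steps).
by rewrite stateS ?state // (tnth_nth L).
Qed.

Lemma history_of_inj p n :
  {in [pred s | size s == (2 * n)%N] &, injective (@history_of p n)}.
Proof.
move=> s s' /eqP sz /eqP sz' eq_s; apply: (@eq_from_nth _ (initial p)).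
  by rewrite sz.
rewrite sz => t tn; have := congr1 (fun x : history p n => x (inord t.+1)) eq_s.
by rewrite !history_of_inord.
Qed.

(** A history is determined by its positions after each step once the
positions at time 0 are prescribed. *)
Lemma history_of_surj p n (x : history p n) : x ord0 = initial p ->
  exists2 s, size s = (2 * n)%N & x = history_of n s.
Proof.
move=> x0; exists [seq x (inord t.+1) | t <- iota 0 (2 * n)].
  by rewrite size_map size_iota.
apply/ffunP => -[[|t] tn]; rewrite ffunE /=.
  by rewrite -x0; congr (x _); apply: val_inj.
rewrite (nth_map 0%N) ?size_iota // nth_iota // add0n; congr (x _).
by apply: val_inj; rewrite /= inordK.
Qed.

End Histories.

Theorem proposition2 (p n : nat) (hp : (1 <= p)%N) (hn : (1 <= n)%N)
    (w : (2 * n).-tuple letter)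
    (hL : count_mem L w = n) (hR : count_mem R w = n) :
  exists C : {fset history p n},
    (forall x : history p n, (x \in C) = configuration x && makes_steps w x) /\
    #|` C|%fset = #|[set pi : {perm 'I_n} | (max_increasing_length pi <= p)%N]|.
Proof.
have size_walk s : s \in walk_list w (initial p) -> size s = (2 * n)%N.
  by rewrite mem_walk_list => /is_walkP [->]; rewrite size_tuple.
exists (seq_fset tt (map (@history_of p n) (walk_list w (initial p)))); split=> [x|].
  rewrite seq_fsetE; apply/mapP/idP => [[s s_in ->] | x_conf].
    by rewrite -is_walk_history ?size_walk // -mem_walk_list.
  have [/and4P [_ _ /eqP x0 _] _] := andP x_conf.
  have [s sz xE] := history_of_surj x0; exists s => //.
  by rewrite mem_walk_list is_walk_history // -xE.
rewrite size_seq_fset undup_id; last first.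
  rewrite map_inj_in_uniq ?uniq_walk_list // => s s' s_in s'_in.
  by apply: history_of_inj; rewrite inE size_walk.
by rewrite size_map size_walk_list (count_walks_profile_sum _ hL hR) profile_sum_lis.
Qed.
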